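(* Let $R$ be a complete intersection SAGA of codimension $6$ presented by quadrics. Then $R$ satisfies the strong Lefschetz property in degree $1$: for general $x\in R^1$ the multiplication map $x^4\cdot:R^1\to R^5$ is an isomorphism.
   Context: $\mathbb K$ is an algebraically closed field of characteristic $0$. A complete intersection SAGA of codimension $n+1$ presented by quadrics is $R=S/I$ with $S=\mathbb K[x_0,\dots,x_n]$ and $I$ generated by a regular sequence of $n+1$ homogeneous quadrics; it is a standard graded Artinian Gorenstein $\mathbb K$-algebra with socle in degree $n+1$ (here $n=5$, socle degree $6$). *)

(* Defs.v *)
From HB Require Import structures.
From mathcomp Require Import all_boot all_order all_algebra.
From mathcomp Require Import mpoly.
Set Implicit Arguments. Unset Strict Implicit. Unset Printing Implicit Defensive.
Import GRing.Theory.
Local Open Scope ring_scope.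

Definition in_ideal_prefix (K : comRingType) (n k : nat)
    (g : 'I_k -> {mpoly K[n]}) (i : nat) (p : {mpoly K[n]}) : Prop :=
  exists c : 'I_k -> {mpoly K[n]}, p = \sum_(j < k | (j < i)%N) c j * g j.

Definition in_ideal (K : comRingType) (n k : nat)
    (g : 'I_k -> {mpoly K[n]}) (p : {mpoly K[n]}) : Prop :=
  in_ideal_prefix g k p.

Definition regular_sequence (K : comRingType) (n k : nat)
    (g : 'I_k -> {mpoly K[n]}) : Prop :=
  ~ in_ideal g 1 /\
  forall (i : 'I_k) (f : {mpoly K[n]}),
    in_ideal_prefix g i (f * g i) -> in_ideal_prefix g i f.

(* R = S/(q) with S = K[x_0..x_n] (n+1 variables) and q a regular sequence
   of n+1 homogeneous quadrics: a complete intersection SAGA of codimension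
   n+1 presented by quadrics. *)
Definition CI_quadric_presentation (K : comRingType) (m : nat)
    (q : 'I_m -> {mpoly K[m]}) : Prop :=
  (forall i, q i \is 2.-homog) /\ regular_sequence q.

Definition linform (K : comRingType) (m : nat) (a : 'I_m -> K) : {mpoly K[m]} :=
  \sum_(i < m) a i *: 'X_i.

(* Multiplication by x^4 : R^1 -> R^5 is an isomorphism of K-vector spaces,
   where R^d = S_d / I_d, expressed through representatives in S. *)
Definition mul_pow4_iso_1_5 (K : comRingType) (m : nat)
    (q : 'I_m -> {mpoly K[m]}) (x : {mpoly K[m]}) : Prop :=
  (forall y : {mpoly K[m]}, y \is 1.-homog ->
      in_ideal q (x ^+ 4 * y) -> in_ideal q y) /\
  (forall f : {mpoly K[m]}, f \is 5.-homog ->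
      exists2 y : {mpoly K[m]}, y \is 1.-homog & in_ideal q (f - x ^+ 4 * y)).

(* Main.v *)
(* Let [R = S/I] and [x^k : R^1 -> R^(k+1)] the multiplication maps.
   Comparing two computations of [Tor(S/I, S/(l_1, ..., l_w))] (by induction on
   the regular sequence, with Koszul complexes) shows that a form of degree [d]
   outside [I] is annihilated modulo [I] by at most [d] independent linear
   forms: multiplication by it on [R^1] has rank at least [6 - d].
   If [x^4 : R^1 -> R^5] is singular for every [x], there is a nonzero
   polynomial map [x |-> y(x)] with [x^4 y = 0].  Differentiating and using the
   triviality of the socle gives [x^i y^j = 0] for [i + j = 5], [j >= 1].  Let
   [D] be the Jacobian of [y].  Differentiating [x^(i+1) y^j = 0] gives
   [(i+1) x^i y^j v + j x^(i+1) y^(j-1) D v = 0], so [D] relates the kernels of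
   [x^i y^j] and [x^(i+1) y^(j-1)], both containing [y]; a dimension count then
   contradicts the rank bound unless [x^i y^j = 0] for [i + j = 4] and [j >= 2],
   then for [i + j = 3] and [j >= 2], then for [y^2].  Finally [y D v = 0] forces [D v] to
   be proportional to [y], hence [x^3 y = 0], [x^2 y = 0], [x y = 0], [y = 0].
   Since [R^1] and [R^5] both have dimension 6, the determinant of [x^4] is the
   required polynomial. *)
Require Import Defs.
From HB Require Import structures.
From mathcomp Require Import all_boot all_order all_algebra.
From mathcomp Require Import mpoly.
From mathcomp Require Import zify.
Import GRing.Theory.
Local Open Scope ring_scope.
Set Implicit Arguments.
Unset Strict Implicit.
Unset Printing Implicit Defensive.

(** * Ideals of the polynomial ring as predicates *)

Section Ideals.
Variables (K : fieldType) (n : nat).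
Local Notation S := {mpoly K[n]}.

Definition is_ideal (J : S -> Prop) :=
  [/\ J 0, forall a b, J a -> J b -> J (a + b) & forall s a, J a -> J (s * a)].

Variable J : S -> Prop.
Hypothesis idJ : is_ideal J.

Lemma idl0 : J 0. Proof. by case: idJ. Qed.
Lemma idlD a b : J a -> J b -> J (a + b). Proof. by case: idJ => _ + _; apply. Qed.
Lemma idlMl s a : J a -> J (s * a). Proof. by case: idJ => _ _; apply. Qed.
Lemma idlMr s a : J a -> J (a * s). Proof. by rewrite mulrC; apply: idlMl. Qed.
Lemma idlN a : J a -> J (- a). Proof. by rewrite -mulN1r; apply: idlMl. Qed.
Lemma idlB a b : J a -> J b -> J (a - b).
Proof. by move=> ? ?; apply/idlD => //; apply/idlN. Qed.
Lemma idlZ c a : J a -> J (c *: a).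
Proof. by rewrite -mul_mpolyC; apply: idlMl. Qed.
Lemma idlZI c a : c != 0 -> J (c *: a) -> J a.
Proof. by move=> c0 /(@idlZ c^-1); rewrite scalerA mulVf // scale1r. Qed.
Lemma idl_sum (I : Type) (r : seq I) (P : pred I) (F : I -> S) :
  (forall i, P i -> J (F i)) -> J (\sum_(i <- r | P i) F i).
Proof. by move=> h; apply: big_ind => //; [apply: idl0 | apply: idlD]. Qed.

End Ideals.

(** * Homogeneous components of products with a form *)

Section Pihomog.
Variables (K : fieldType) (n : nat).
Local Notation S := {mpoly K[n]}.
Local Notation pih := (pihomog mdeg).

Lemma pihomog_partE (p : S) k : (msize p <= k)%N -> p = \sum_(d < k) pih d p.
Proof. exact: pihomog_partitionE. Qed.

Lemma pihomogM d e (g p : S) : g \is d.-homog -> pih (e + d) (g * p) = g * pih e p.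
Proof.
move=> hg; pose k := maxn (msize p) e.+1.
have hk : (msize p <= k)%N by rewrite leq_maxl.
rewrite {1}(pihomog_partE hk) mulr_sumr raddf_sum /=.
have he : (e < k)%N by rewrite leq_maxr.
rewrite (bigD1 (Ordinal he)) //= big1 ?addr0.
  by rewrite pihomog_dE // addnC; apply: dhomogM => //; apply: pihomogP.
move=> i ne; apply: (@pihomog_ne0 _ _ _ (d + i)%N).
  by rewrite addnC eqn_add2r; apply: contraNneq ne => h; apply/eqP/val_inj.
by apply: dhomogM => //; apply: pihomogP.
Qed.

Lemma pihomogM0 d e (g p : S) : g \is d.-homog -> (e < d)%N -> pih e (g * p) = 0.
Proof.
move=> hg ed; rewrite (pihomog_partE (leqnn (msize p))) mulr_sumr raddf_sum /= big1 // => i _.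
apply: (@pihomog_ne0 _ _ _ (d + i)%N); last first.
  by apply: dhomogM => //; apply: pihomogP.
by rewrite neq_ltn orbC (leq_trans ed) // leq_addr.
Qed.

End Pihomog.

(** * Koszul complexes and their bigrading *)

Section Koszul.
Variables (K : fieldType) (n : nat).
Local Notation S := {mpoly K[n]}.
Local Notation pih := (pihomog mdeg).

(** The Koszul complex on [w] elements, all homological degrees together, as an iterated mapping
    cone: a pair [(a, b)] stands for [a + e_(w-1) ^ b]. *)
Fixpoint kz (w : nat) : lmodType S :=
  match w with
  | 0 => S^o
  | w'.+1 => ((kz w' * kz w')%type : lmodType S)
  end.

Fixpoint kd (l : nat -> S) w : kz w -> kz w :=
  match w return kz w -> kz w with
  | 0 => fun=> 0
  | w'.+1 => fun c => (kd l c.1 + l w' *: c.2, - kd l c.2)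
  end.

(** Projection to homological degree [i] and coefficients of degree [p]. For linear forms the
    differential maps bidegree [(i+1, p)] to [(i, p+1)]. *)
Fixpoint kpi w (i p : nat) : kz w -> kz w :=
  match w return kz w -> kz w with
  | 0 => fun s => if i is 0 then pih p s else 0
  | w'.+1 => fun c => (kpi i p c.1, if i is i'.+1 then kpi i' p c.2 else 0)
  end.

Fixpoint kall (J : S -> Prop) w : kz w -> Prop :=
  match w return kz w -> Prop with
  | 0 => J
  | w'.+1 => fun c => kall J c.1 /\ kall J c.2
  end.

Fixpoint kinj w (s : S) : kz w :=
  match w return kz w with
  | 0 => s
  | w'.+1 => (kinj w' s, 0)
  end.

Fixpoint kproj w : kz w -> S :=
  match w return kz w -> S with
  | 0 => id
  | w'.+1 => fun c => kproj c.1
  end.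

Lemma kd_linear l w : linear (@kd l w).
Proof.
elim: w => [|w ih] a u v /=; first by rewrite scaler0 addr0.
rewrite !ih; congr (_, _); last by rewrite /= opprD scalerN.
by rewrite /= !scalerDr !scalerA mulrC addrACA.
Qed.

HB.instance Definition _ l w :=
  GRing.isLinear.Build S (kz w) (kz w) _ (@kd l w) (@kd_linear l w).

Lemma kdd l w (c : kz w) : kd l (kd l c) = 0.
Proof.
elim: w c => [|w ih] c //=.
rewrite linearD linearZ linearN /= !ih add0r.
by rewrite subrr linearN /= ih !oppr0.
Qed.

Lemma kpi_additive w i p : zmod_morphism (@kpi w i p).
Proof.
elim: w i p => [|w ih] [|i] p u v /=; rewrite ?subr0 ?raddfB //=.
  by rewrite ih; congr (_, _); rewrite /= subr0.
by rewrite !ih.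
Qed.

HB.instance Definition _ w i p :=
  GRing.isZmodMorphism.Build (kz w) (kz w) (@kpi w i p) (@kpi_additive w i p).

Lemma kpi_id w i p (c : kz w) : kpi i p (kpi i p c) = kpi i p c.
Proof.
elim: w i c => [|w ih] [|i] c //=; first exact: pihomog_id.
  by rewrite ih.
by rewrite !ih.
Qed.

Lemma kpiZ w i p d g (c : kz w) : g \is d.-homog ->
  kpi i (p + d) (g *: c) = g *: kpi i p c.
Proof.
move=> hg; elim: w i c => [|w ih] [|i] c /=; first exact: pihomogM.
- by rewrite scaler0.
- by rewrite ih; congr (_, _); rewrite /= scaler0.
- by rewrite !ih.
Qed.

Lemma kpiZ0 w i p d g (c : kz w) : g \is d.-homog -> (p < d)%N ->
  kpi i p (g *: c) = 0.
Proof.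
move=> hg pd; elim: w i c => [|w ih] [|i] c //=; first exact: pihomogM0 pd.
  by rewrite ih.
by rewrite !ih.
Qed.

Variable l : nat -> S.

Definition lin_to w := forall t, (t < w)%N -> l t \is 1.-homog.

Lemma lin_toS w : lin_to w.+1 -> lin_to w.
Proof. by move=> h t tw; apply: h; apply: ltnW. Qed.

Lemma kd_kpi0 w p (c : kz w) : kd l (kpi 0 p c) = 0.
Proof. by elim: w c => [|w ih] c //=; rewrite ih scaler0 addr0 raddf0 oppr0. Qed.

Lemma kpi_kd0 w i (c : kz w) : lin_to w -> kpi i 0 (kd l c) = 0.
Proof.
elim: w i c => [|w ih] i c hl /=; first by case: i => //; rewrite raddf0.
rewrite raddfD /= ih ?add0r; last exact: lin_toS.
rewrite (@kpiZ0 _ _ _ 1%N) //; last exact: hl.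
case: i => // i; rewrite raddfN /= ih ?oppr0 //; exact: lin_toS.
Qed.

Lemma kd_kpi w i p (c : kz w) : lin_to w ->
  kd l (kpi i.+1 p c) = kpi i p.+1 (kd l c).
Proof.
elim: w i c => [|w ih] i c hl /=; first by case: i => //; rewrite raddf0.
rewrite ih; last exact: lin_toS.
rewrite raddfD /= -addn1 (@kpiZ _ _ _ 1%N); last exact: hl.
congr (_, _); case: i => [|i] /=; first by rewrite kd_kpi0 oppr0.
rewrite addn1 raddfN ih //; exact: lin_toS.
Qed.

Section KAll.
Variable J : S -> Prop.
Hypothesis idJ : is_ideal J.

Lemma kall0 w : kall J (0 : kz w).
Proof. by elim: w => [|w ih] //=; apply: idl0. Qed.
Lemma kallD w (a b : kz w) : kall J a -> kall J b -> kall J (a + b).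
Proof.
elim: w a b => [|w ih] a b /=; first exact: idlD.
by move=> [? ?] [? ?]; split; apply: ih.
Qed.
Lemma kallZ w s (a : kz w) : kall J a -> kall J (s *: a).
Proof.
elim: w a => [|w ih] a /=; first exact: idlMl.
by move=> [? ?]; split; apply: ih.
Qed.
Lemma kallN w (a : kz w) : kall J a -> kall J (- a).
Proof. by rewrite -scaleN1r; apply: kallZ. Qed.
Lemma kall_kd w (a : kz w) : kall J a -> kall J (kd l a).
Proof.
elim: w a => [|w ih] a /=; first by move=> _; apply: idl0.
case=> h1 h2; split; last by apply/kallN/ih.
by apply: kallD; [apply: ih | apply: kallZ].
Qed.

Lemma kall_kpi w i p (a : kz w) : (forall d s, J s -> J (pih d s)) ->
  kall J a -> kall J (kpi i p a).
Proof.
move=> gr; elim: w i a => [|w ih] i a /=.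
  by case: i => [|i] h; [apply: gr | apply: idl0].
case: i => [|i] [h1 h2]; split; [exact: ih|exact: kall0|exact: ih|exact: ih].
Qed.

(* A boundary modulo a graded ideal is the boundary of its component in the
   right bidegree; the second conclusion also covers degree -1, where that
   component vanishes. *)
Lemma kd_homogenize w i p (c e : kz w) :
    (forall d s, J s -> J (pih d s)) -> lin_to w ->
    kpi i p c = c -> kall J (c - kd l e) ->
  exists2 e', kall J (c - kd l e') &
    forall d g, g \is d.+1.-homog -> kpi i.+1 (p + d) (g *: e') = g *: e'.
Proof.
move=> gr hl hc /(kall_kpi i p gr); rewrite raddfB /= hc.
case: p hc => [|p] hc.
  rewrite kpi_kd0 // => h; exists 0; first by rewrite raddf0.
  by move=> d g _; rewrite scaler0 raddf0.
rewrite -kd_kpi // => h; exists (kpi i.+1 p e) => // d g hg.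
by rewrite addSnnS (kpiZ _ _ _ hg) kpi_id.
Qed.

End KAll.

End Koszul.

(** * Exactness of the Koszul complex of independent linear forms *)

Section KoszulExact.
Variables (K : fieldType) (n : nat).
Local Notation S := {mpoly K[n]}.
Local Notation pih := (pihomog mdeg).
Variable l : nat -> S.

Definition zero_ideal (s : S) : Prop := s = 0.

Lemma zero_is_ideal : is_ideal zero_ideal.
Proof. by split=> [|a b -> ->|s a ->] //; rewrite /zero_ideal ?addr0 ?mulr0. Qed.

Lemma kall_zero w (c : kz K n w) : kall zero_ideal c <-> c = 0.
Proof.
elim: w c => [|w ih] c //=; split; first by case: c => a b /= [/ih -> /ih ->].
by move->; split; apply/ih.
Qed.

Lemma kprojD w (a b : kz K n w) : kproj (a + b) = kproj a + kproj b.
Proof. by elim: w a b => [|w ih] a b //=; rewrite ih. Qed.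
Lemma kprojZ w s (a : kz K n w) : kproj (s *: a) = s * kproj a.
Proof. by elim: w a => [|w ih] a //=; rewrite ih. Qed.

Lemma kinjB w (s t : S) : kinj w (s - t) = kinj w s - kinj w t.
Proof. by elim: w => [|w ih] //=; rewrite ih; congr (_, _); rewrite /= subr0. Qed.
Lemma kinjZ w (s t : S) : kinj w (s * t) = s *: kinj w t.
Proof. by elim: w => [|w ih] //=; rewrite ih; congr (_, _); rewrite /= scaler0. Qed.
Lemma kinj0 w : kinj w (0 : S) = 0.
Proof. by rewrite -(subrr 0) kinjB subrr. Qed.

Lemma kd_kinj w s : kd l (kinj w s) = 0.
Proof. by elim: w => [|w ih] //=; rewrite ih scaler0 addr0 raddf0 oppr0. Qed.

Lemma kinj_kproj w p (c : kz K n w) : kpi 0 p c = c -> kinj w (kproj c) = c.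
Proof.
elim: w c => [|w ih] //= [a b] /= [ha hb].
by rewrite ih // hb.
Qed.

(** The ideal generated by [l 0, ..., l (w-1)], encoded as the boundaries in homological degree
    0. *)
Definition lin_ideal w (s : S) : Prop := exists c : kz K n w, kinj w s = kd l c.

Lemma lin_ideal_is_ideal w : is_ideal (lin_ideal w).
Proof.
split; first by exists 0; rewrite raddf0 kinj0.
- move=> a b [c hc] [d hd]; exists (c + d); rewrite raddfD /= -hc -hd.
  by rewrite -[b in LHS]opprK kinjB -[- b]sub0r kinjB kinj0 sub0r opprK.
- by move=> s a [c hc]; exists (s *: c); rewrite linearZ /= -hc kinjZ.
Qed.

Lemma lin_ideal_l w t : (t < w)%N -> lin_ideal w (l t).
Proof.
elim: w => [//|w ih]; rewrite ltnS leq_eqVlt => /orP[/eqP ->|/ih [c hc]].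
  exists (0, kinj w 1); rewrite /= raddf0 add0r kd_kinj oppr0.
  by rewrite -kinjZ mulr1.
by exists (c, 0); rewrite /= scaler0 addr0 raddf0 oppr0 hc.
Qed.

(** A witness that [l w] is a nonzerodivisor modulo the earlier forms: [phi] embeds the quotient by
    them into the domain [S] and does not kill [l w]. *)
Definition projection_along w (phi : {rmorphism S -> S}) :=
  [/\ forall t, (t < w)%N -> phi (l t) = 0, phi (l w) != 0 &
      forall s, lin_ideal w (s - phi s)].

Lemma kproj_kd w (phi : {rmorphism S -> S}) (c : kz K n w) :
  (forall t, (t < w)%N -> phi (l t) = 0) -> phi (kproj (kd l c)) = 0.
Proof.
elim: w c => [|w ih] c h /=; first by rewrite raddf0.
rewrite kprojD kprojZ rmorphD rmorphM /= h // mul0r addr0 ih // => t tw.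
by apply: h; apply: ltnW.
Qed.

(** For a cycle [(a, b)] the part [b] is a boundary [kd l e1]; then [a + l w *: e1] is a cycle,
    hence some [kd l e2], and [(a, b)] is the boundary of [(e2, - e1)]. *)
Lemma koszul_exact w : lin_to l w ->
    (forall t, (t < w)%N -> exists phi, projection_along t phi) ->
  forall i p (c : kz K n w), kpi i.+1 p c = c -> kd l c = 0 ->
    exists e, c = kd l e.
Proof.
elim: w => [|w ih] hl hphi i p c /=; first by move=> <- _; exists 0.
have {}ih := ih (lin_toS hl) (fun t tw => hphi t (ltnW tw)).
case: c => a b /= [ha hb] h.
have hda : kd l a + l w *: b = 0 := congr1 fst h.
have hdb : kd l b = 0 by apply/eqP; rewrite -oppr_eq0; apply/eqP/(congr1 snd h).
have [e0 hbe0] : exists e, b = kd l e.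
  case: i ha hb => [|i] ha hb; last exact: ih hb hdb.
  (* In homological degree 0 being a cycle says nothing about [b]. Applying [phi] to the first
     component leaves [phi (l w) * phi b = 0], so [b] lies in the ideal of the earlier forms. *)
  have [phi [phil phiw phis]] := hphi w (ltnSn w).
  have /eqP : phi (kproj (kd l a + l w *: b)) = 0 by rewrite hda -(scale0r 0) kprojZ mul0r raddf0.
  rewrite kprojD kprojZ rmorphD rmorphM /= kproj_kd // add0r mulf_eq0.
  rewrite (negPf phiw) /= => /eqP hb0.
  have [e he] := phis (kproj b).
  by exists e; rewrite -he hb0 subr0 (kinj_kproj hb).
have gr0 d s : zero_ideal s -> zero_ideal (pih d s).
  by move=> ->; rewrite /zero_ideal raddf0.
have hb0 : kall zero_ideal (b - kd l e0) by apply/kall_zero; rewrite -hbe0 subrr.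
(* The preimage of [b] is made homogeneous so that [a + l w *: e1] keeps bidegree [(i+1, p)], as the
   induction hypothesis requires. *)
have [e1 he1 hhom] := kd_homogenize zero_is_ideal gr0 (lin_toS hl) hb hb0.
have {}he1 : b = kd l e1 by apply/eqP; rewrite -subr_eq0; apply/eqP/kall_zero.
have hlw : l w \is 1.-homog by apply: hl.
have [||e2 he2] := ih i p (a + l w *: e1).
- by rewrite raddfD /= ha -[in RHS](hhom 0%N) // addn0.
- by rewrite linearD linearZ /= -he1.
exists (e2, - e1) => /=; rewrite -he2 scalerN addrK raddfN opprK he1.
by [].
Qed.

End KoszulExact.

(** * Koszul homology with coefficients in the complete intersection *)

Section KoszulVanishing.
Variables (K : fieldType) (n m : nat).
Local Notation S := {mpoly K[n]}.
Local Notation pih := (pihomog mdeg).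
Variable g : 'I_m -> S.
Local Notation J k := (in_ideal_prefix g k).

Lemma prefix_is_ideal k : is_ideal (J k).
Proof.
split.
- by exists (fun=> 0); rewrite big1 // => j _; rewrite mul0r.
- move=> a b [c ->] [d ->]; exists (fun j => c j + d j).
  by rewrite -big_split; apply: eq_bigr => j _; rewrite /= mulrDl.
- move=> s a [c ->]; exists (fun j => s * c j).
  by rewrite mulr_sumr; apply: eq_bigr => j _; rewrite mulrA.
Qed.

Lemma prefix0 s : J 0 s <-> s = 0.
Proof.
split=> [[c ->]|->]; first by rewrite big1.
exact: (idl0 (prefix_is_ideal 0)).
Qed.

Lemma prefixS (k : 'I_m) s : J k.+1 s <-> exists e, J k (s - g k * e).
Proof.
split=> [[c ->]|[e [c hc]]].
  exists (c k); exists c; rewrite (bigD1 k) //= [g k * _]mulrC addrAC subrr add0r.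
  apply: eq_bigl => j; rewrite ltnS leq_eqVlt -val_eqE /=.
  by case: eqVneq => [->|ne] /=; rewrite ?ltnn ?andbT.
exists (fun j => if j == k then e else c j).
rewrite (bigD1 k) //= eqxx mulrC -[LHS](subrK (g k * e)) hc addrC; congr (_ + _).
apply: eq_big => [j|j jk].
  rewrite [in RHS]ltnS [in RHS]leq_eqVlt -val_eqE /=.
  by case: eqVneq => [->|ne] /=; rewrite ?ltnn ?andbT.
by rewrite -val_eqE /= (ltn_eqF jk).
Qed.

Lemma prefix_mem (k : 'I_m) : J k.+1 (g k).
Proof.
apply/prefixS; exists 1; rewrite mulr1 subrr; exact: (idl0 (prefix_is_ideal k)).
Qed.

Lemma prefix_leS (k : 'I_m) s : J k s -> J k.+1 s.
Proof. by move=> h; apply/prefixS; exists 0; rewrite mulr0 subr0. Qed.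

Hypothesis g2 : forall j, g j \is 2.-homog.

Lemma prefix_graded k d s : J k s -> J k (pih d s).
Proof.
move=> [c ->]; rewrite raddf_sum /=; apply: idl_sum; first exact: prefix_is_ideal.
move=> j jk; rewrite mulrC.
have hg : J k (g j).
  exists (fun i => (i == j)%:R); rewrite (bigD1 j) //= eqxx mul1r big1 ?addr0 //.
  by move=> i /andP[_ /negPf ->]; rewrite mul0r.
have [d2|d2] := ltnP d 2.
  by rewrite (pihomogM0 _ (g2 j)) //; apply: idl0; apply: prefix_is_ideal.
rewrite -(subnK d2) (pihomogM _ _ (g2 j)).
exact: (idlMr (prefix_is_ideal k) _ hg).
Qed.

Hypothesis gR : forall (i : 'I_m) f, J i (f * g i) -> J i f.

Lemma kall_prefixS w (k : 'I_m) (c : kz K n w) :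
  kall (J k.+1) c -> exists e, kall (J k) (c - g k *: e).
Proof.
elim: w c => [|w ih] c /=; first by move/prefixS.
by case=> /ih [e1 h1] /ih [e2 h2]; exists (e1, e2).
Qed.

Lemma kall_prefixMl w (k : 'I_m) (c : kz K n w) :
  kall (J k) (g k *: c) -> kall (J k) c.
Proof.
elim: w c => [|w ih] c /=; last by case=> /ih ? /ih.
by move=> h; apply: gR; rewrite mulrC.
Qed.

Lemma kall_sub (J1 J2 : S -> Prop) w (c : kz K n w) :
  (forall s, J1 s -> J2 s) -> kall J1 c -> kall J2 c.
Proof. by move=> h; elim: w c => [|w ih] c /=; [apply: h | case=> /ih ? /ih]. Qed.

Lemma kall_gen w (k : 'I_m) (c : kz K n w) : kall (J k.+1) (g k *: c).
Proof.
elim: w c => [|w ih] c /=; last by [].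
by apply: idlMr; [apply: prefix_is_ideal | apply: prefix_mem].
Qed.

Variables (l : nat -> S) (w : nat).
Hypothesis hl : lin_to l w.
Hypothesis hphi : forall t, (t < w)%N -> exists phi, projection_along l t phi.

(* Koszul homology of the [l_t] with coefficients in S/(g_0, ..., g_(k-1)) is
   that of a resolution generated by the quadrics: in homological degree [i]
   it lives in polynomial degrees at least [i]. *)
Lemma koszul_vanishing k i p (c : kz K n w) : (k <= m)%N -> (p < i)%N ->
  kpi i p c = c -> kall (J k) (kd l c) -> exists e, kall (J k) (c - kd l e).
Proof.
elim: k i p c => [|k ih] [|i] p c //= km pi hc hd.
  have [|e he] := koszul_exact hl hphi hc.
    by apply/kall_zero; apply: kall_sub hd => s /prefix0.
  by exists e; rewrite he subrr; apply: kall0; apply: prefix_is_ideal.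
pose kk := Ordinal km; have idk := prefix_is_ideal k.
have up w' (a : kz K n w') : kall (J k) a -> kall (J k.+1) a.
  by apply: kall_sub => s; apply: (@prefix_leS kk).
have hdh : kpi i p.+1 (kd l c) = kd l c by rewrite -kd_kpi // hc.
have [e0 he0] := @kall_prefixS _ kk _ hd.
have hgr d s : J k s -> J k (pih d s) by apply: prefix_graded.
(* If [p = 0], then [kd l c] has linear coefficients, below the degree of the quadric [g kk], so [c]
   is already a cycle modulo [J k]. *)
case: p pi hc hdh => [|p] pi hc hdh.
  have := kall_kpi idk i 1 hgr he0.
  rewrite raddfB /= hdh (kpiZ0 _ _ (g2 kk)) // subr0.
  move=> h; have [e he] := ih i.+1 0%N c (ltnW km) pi hc h.
  by exists e; apply: up.
have := kall_kpi idk i p.+2 hgr he0.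
rewrite raddfB /= hdh -[p.+2]addn2 (kpiZ _ _ _ (g2 kk)).
set e := kpi i p e0 => he.
(* Modulo [J k], [kd l c] equals [g kk *: e], so regularity makes [e] a cycle. Its bidegree [(i, p)]
   still has [p < i], so [e] is a boundary [kd l e2] and [c - g kk *: e2] is a cycle modulo
   [J k]. *)
have hde : kall (J k) (kd l e).
  apply: (@kall_prefixMl _ kk); have := kall_kd l idk he.
  by rewrite linearB linearZ /= kdd sub0r => /(kallN idk); rewrite opprK.
have [e1 he1] := ih i p e (ltnW km) pi (kpi_id _ _ _) hde.
have [e2 he2 hom2] := kd_homogenize idk hgr hl (kpi_id i p e0) he1.
have [||e3 he3] := ih i.+1 p.+1 (c - g kk *: e2) (ltnW km) pi.
- by rewrite raddfB /= hc; have := hom2 1%N _ (g2 kk); rewrite addn1 => ->.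
- rewrite linearB linearZ /=.
  have -> : kd l c - g kk *: kd l e2 = (kd l c - g kk *: e) + g kk *: (e - kd l e2).
    by rewrite scalerBr addrA subrK.
  by apply: kallD => //; apply: kallZ.
exists e3; have -> : c - kd l e3 = (c - g kk *: e2 - kd l e3) + g kk *: e2.
  by rewrite addrAC subrK.
apply: kallD; [exact: prefix_is_ideal | exact: up | exact: (@kall_gen _ kk)].
Qed.

Fixpoint ktop w (s : S) : kz K n w :=
  match w return kz K n w with
  | 0 => s
  | w'.+1 => (0, ktop w' s)
  end.

Lemma kpi_gt w' i p (c : kz K n w') : (w' < i)%N -> kpi i p c = 0.
Proof.
elim: w' i c => [|w' ihw] [|i] c //= wi; rewrite !ihw //.
exact: ltnW.
Qed.

Lemma kpi_ktop w' p s : s \is p.-homog -> kpi w' p (ktop w' s) = ktop w' s.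
Proof.
move=> hs; elim: w' => [|w' ihw] /=; first exact: pihomog_dE.
by rewrite ihw kpi_gt.
Qed.

Lemma ktopZ w' r s : ktop w' (r * s) = r *: ktop w' s.
Proof. by elim: w' => [|w' ihw] //=; rewrite ihw; congr (_, _); rewrite /= scaler0. Qed.

Lemma kall_ktop (I : S -> Prop) w' s : is_ideal I -> kall I (ktop w' s) <-> I s.
Proof.
move=> idI; elim: w' => [|w' ihw] //=; split; first by case=> _ /ihw.
by move=> h; split; [apply: kall0 | apply/ihw].
Qed.

Lemma kd_ktop (I : S -> Prop) w' s : is_ideal I ->
  (forall t, (t < w')%N -> I (l t * s)) -> kall I (kd l (ktop w' s)).
Proof.
move=> idI; elim: w' => [|w' ihw] h /=; first exact: idl0.
rewrite raddf0 add0r; split.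
  by rewrite -ktopZ; apply/kall_ktop => //; apply: h.
by apply: kallN => //; apply: ihw => t tw; apply: h; apply: ltnW.
Qed.

(** The element [s e_0 ^ ... ^ e_(w-1)] is a cycle modulo the ideal, of bidegree [(w, j)] with
    [j < w], hence a boundary. Nothing lives in homological degree [w + 1], so [s] is zero modulo
    the ideal. *)
Lemma ann_linear_degree j s : s \is j.-homog -> (j < w)%N ->
  (forall t, (t < w)%N -> J m (l t * s)) -> J m s.
Proof.
move=> hs jw hann; have idm := prefix_is_ideal m.
have hgr d r : J m r -> J m (pih d r) by apply: prefix_graded.
have [e he] := koszul_vanishing (leqnn m) jw (kpi_ktop w hs) (kd_ktop idm hann).
have := kall_kpi idm w j hgr he.
rewrite raddfB /= kpi_ktop //.
case: j jw hs => [|j] jw hs; first by rewrite kpi_kd0 // subr0 => /(kall_ktop _ _ idm).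
by rewrite -kd_kpi // kpi_gt // raddf0 subr0 => /(kall_ktop _ _ idm).
Qed.

End KoszulVanishing.

(** * Linear forms as row vectors, and their annihilators *)

Section LinearForms.
Variables (K : fieldType) (n : nat).
Local Notation S := {mpoly K[n]}.

Lemma mpoly_ring_ind (P : S -> Prop) :
    (forall c, P c%:MP) -> (forall i, P 'X_i) ->
    (forall p q, P p -> P q -> P (p + q)) ->
    (forall p q, P p -> P q -> P (p * q)) -> forall p, P p.
Proof.
move=> hC hX hD hM p; rewrite (mpolyE p).
apply: (big_ind P); [by rewrite -mpolyC0 | exact: hD | move=> m _].
rewrite -mul_mpolyC mpolyXE_id; apply: (hM) => //.
apply: (big_ind P); [by rewrite -mpolyC1 | exact: hM | move=> i _].
elim: (m i) => [|k ih]; first by rewrite expr0 -mpolyC1.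
by rewrite exprS; apply: hM.
Qed.

Lemma linform_homog (a : 'I_n -> K) : linform a \is 1.-homog.
Proof.
rewrite /linform rpred_sum // => i _; apply: rpredZ.
by rewrite dhomogX /= mdeg1.
Qed.

Lemma linform_eq (a b : 'I_n -> K) : a =1 b -> linform a = linform b.
Proof. by move=> h; apply: eq_bigr => i _; rewrite h. Qed.

Lemma linformD (a b : 'I_n -> K) :
  linform a + linform b = linform (fun i => a i + b i).
Proof. by rewrite -big_split; apply: eq_bigr => i _; rewrite /= scalerDl. Qed.

Lemma linformZ c (a : 'I_n -> K) : c *: linform a = linform (fun i => c * a i).
Proof. by rewrite scaler_sumr; apply: eq_bigr => i _; rewrite scalerA. Qed.

Lemma linform_coeff (a : 'I_n -> K) i : (linform a)@_U_(i) = a i.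
Proof.
rewrite /linform raddf_sum /= (bigD1 i) //= mcoeffZ mcoeffX eqxx mulr1 big1 ?addr0 //.
move=> j ne; rewrite mcoeffZ mcoeffX; case: eqP => [/mnmP /(_ i)|_]; last by rewrite mulr0.
by rewrite !mnm1E eqxx (negPf ne).
Qed.

Lemma homog1_linform (p : S) : p \is 1.-homog -> p = linform (fun i => p@_U_(i)).
Proof.
move=> hp; apply/mpolyP => m.
have [/eqP h1|h1] := boolP (mdeg m == 1%N).
  have /mdeg1P [i /eqP ->] : mdeg m == 1%N by apply/eqP.
  by rewrite linform_coeff.
by rewrite !(dhomog_nemf_coeff _ h1) // linform_homog.
Qed.

Definition rowform (v : 'rV[K]_n) : S := linform (fun i => v 0 i).

Lemma rowform_is_linear : linear rowform.
Proof.
move=> c u v; rewrite /rowform linformZ linformD.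
by apply: linform_eq => i; rewrite !mxE.
Qed.

HB.instance Definition _ :=
  GRing.isLinear.Build K 'rV[K]_n S _ rowform rowform_is_linear.

Lemma rowform_homog v : rowform v \is 1.-homog.
Proof. exact: linform_homog. Qed.

Lemma rowform_eq0 v : (rowform v == 0) = (v == 0).
Proof.
apply/eqP/eqP => [h|->]; last by rewrite raddf0.
by apply/rowP => i; rewrite mxE -(linform_coeff (v 0)) -/(rowform v) h mcoeff0.
Qed.

Section RowFree.
Variables (w : nat) (L : 'M[K]_(w, n)).
Hypothesis Lfree : row_free L.

Definition row_seq (t : nat) : S :=
  if insub t is Some i then rowform (row i L) else 0.

Lemma row_seqE (i : 'I_w) : row_seq i = rowform (row i L).
Proof. by rewrite /row_seq valK. Qed.

Lemma row_seq_lin : lin_to row_seq w.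
Proof. by move=> t tw; rewrite -[t]/(val (Ordinal tw)) row_seqE rowform_homog. Qed.

(** With [R] a right inverse of [L], the substitution sending [X_i] to [X_i] minus the sum of
    [R i s *: row_seq s] over [s < t] kills the forms of index below [t] and fixes the others. *)
Lemma row_seq_projection t : (t < w)%N -> exists phi, projection_along row_seq t phi.
Proof.
move=> tw; have /row_freeP [R hR] := Lfree.
pose f i : S := 'X_i - \sum_(s < w | (s < t)%N) R i s *: row_seq s.
pose phi : {rmorphism S -> S} := comp_mpoly [tuple f i | i < n].
have phiC c : phi c%:MP = c%:MP by rewrite /phi /= comp_mpolyC.
have phiX i : phi 'X_i = f i.
  by rewrite /phi /= /comp_mpoly mmapX mmap1U tnth_mktuple.
have phil (s : 'I_w) : phi (row_seq s) = if (s < t)%N then 0 else row_seq s.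
  have -> : phi (row_seq s) = row_seq s - \sum_(r < w | (r < t)%N) (s == r)%:R *: row_seq r.
    rewrite {1 2}row_seqE /rowform /linform raddf_sum /=.
    transitivity (\sum_i (row s L 0 i *: 'X_i -
        \sum_(r < w | (r < t)%N) (L s i * R i r) *: row_seq r)).
      apply: eq_bigr => i _; rewrite -mul_mpolyC rmorphM /= phiC phiX /f.
      rewrite !mul_mpolyC scalerBr scaler_sumr; congr (_ - _).
      by apply: eq_bigr => r _; rewrite scalerA mxE.
    rewrite sumrB exchange_big /=; congr (_ - _); apply: eq_bigr => r _.
    rewrite -scaler_suml; congr (_ *: _).
    by move/matrixP: hR => /(_ s r); rewrite !mxE.
  case: ifP => st; last first.
    rewrite big1 ?subr0 // => r rt; case: eqP => [e|_]; last by rewrite scale0r.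
    by rewrite e rt in st.
  rewrite (bigD1 s) //= eqxx scale1r big1 ?addr0 ?subrr // => r /andP[_ ne].
  by rewrite eq_sym (negPf ne) scale0r.
exists phi; split.
- by move=> s st; have := phil (Ordinal (ltn_trans st tw)); rewrite /= st.
- have := phil (Ordinal tw); rewrite /= ltnn => ->.
  rewrite -[t]/(val (Ordinal tw)) row_seqE rowform_eq0.
  apply/eqP => h; move: hR => /(congr1 (row (Ordinal tw))).
  rewrite row_mul h mul0mx row1 => /rowP /(_ (Ordinal tw)).
  by rewrite !mxE !eqxx => /eqP; rewrite eq_sym oner_eq0.
- have idl := lin_ideal_is_ideal row_seq t.
  elim/mpoly_ring_ind => [c|i|p q hp hq|p q hp hq].
  + by rewrite phiC subrr; apply: idl0.
  + rewrite phiX /f opprB addrC subrK; apply: idl_sum => // s st.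
    by apply: idlZ => //; apply: lin_ideal_l.
  + by rewrite rmorphD opprD addrACA; apply: idlD.
  + rewrite rmorphM.
    have -> : p * q - phi p * phi q = p * (q - phi q) + (p - phi p) * phi q.
      by rewrite mulrBr mulrBl addrA subrK.
    by apply: idlD => //; [apply: idlMl | apply: idlMr].
Qed.

End RowFree.

Section Annihilators.
Variables (m : nat) (g : 'I_m -> S).
Hypothesis g2 : forall j, g j \is 2.-homog.
Hypothesis gR : regular_sequence g.
Local Notation J := (in_ideal g).

Lemma in_ideal_is_ideal : is_ideal J.
Proof. exact: prefix_is_ideal. Qed.

Lemma ann_row_free j w (L : 'M[K]_(w, n)) s : s \is j.-homog -> (j < w)%N ->
  row_free L -> (forall i, J (s * rowform (row i L))) -> J s.
Proof.
move=> hs jw Lfree h; case: gR => _ gR'.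
apply: (ann_linear_degree g2 gR' (row_seq_lin L) (row_seq_projection Lfree) hs jw).
move=> t tw; rewrite mulrC -[t]/(val (Ordinal tw)) row_seqE; exact: h.
Qed.

Lemma ann_submx j w (A : 'M[K]_(w, n)) s : s \is j.-homog -> (j < \rank A)%N ->
  (forall v, (v <= A)%MS -> J (s * rowform v)) -> J s.
Proof.
move=> hs jw h; apply: (ann_row_free hs jw (row_base_free A)) => i.
by apply: h; rewrite (submx_trans (row_sub _ _)) // eq_row_base.
Qed.

(** The socle has no element of degree below [n], since the linear forms span a space of dimension
    [n]. *)
Lemma ann_all j s : s \is j.-homog -> (j < n)%N ->
  (forall v, J (s * rowform v)) -> J s.
Proof.
move=> hs jn h; apply: (@ann_submx j n 1%:M) => //.
by rewrite mxrank1.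
Qed.

End Annihilators.
End LinearForms.

(** * Dimensions of the graded pieces of the quotient *)

Lemma mxrank_adds_coker (F : fieldType) m1 m2 n (A : 'M[F]_(m1, n)) (B : 'M_(m2, n)) :
  \rank (A + B)%MS = (\rank A + \rank (B *m cokermx A))%N.
Proof.
have e : (kermx (cokermx A) :=: A)%MS.
  apply/eqmxP/andP; split; last by rewrite sub_kermx mulmx_coker.
  by rewrite submxE mulmx_ker.
apply/eqP; rewrite -(eqn_add2r (\rank (A :&: B)%MS)) mxrank_sum_cap -addnA.
by rewrite -[X in (_ + X)%N == _](mxrank_mul_ker B (cokermx A)) (cap_eqmx (eqmx_refl B) e) capmxC.
Qed.

Section QuotientDimension.
Import VectorInternalTheory.
Variables (K : fieldType) (n m : nat).
Local Notation S := {mpoly K[n.+1]}.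
Local Notation V d := (dhomog n.+1 K d).
Local Notation N d := (dim (dhomog n.+1 K d)).
Local Notation pih := (pihomog mdeg).
Variable g : 'I_m -> S.
Hypothesis g2 : forall j, g j \is 2.-homog.
Hypothesis gR : regular_sequence g.
Local Notation J k := (in_ideal_prefix g k).

(** The dimension of the degree [d] piece of [J k]. Adding the quadric of index [k'] contributes a
    copy of the quotient by [J k'] in degree [d - 2]. *)
Fixpoint ideal_dim (k d : nat) : nat :=
  if k is k'.+1 then
    ideal_dim k' d + (if d is e.+2 then 'C(e + n, e) - ideal_dim k' e else 0)
  else 0.

Definition part d (p : S) : V d := DHomog (pihomogP mdeg d p).

Lemma part_is_linear d : linear (@part d).
Proof. by move=> c p q; apply/val_inj; rewrite /= linearP. Qed.

HB.instance Definition _ d :=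
  GRing.isLinear.Build K S (V d) _ (@part d) (@part_is_linear d).

(** By regularity, multiplication by [g kk] from degree [e] to the quotient by [J k] in degree
    [e + 2] has kernel exactly the degree [e] piece of [J k]; rank-nullity gives the recursion of
    [ideal_dim]. *)
Lemma ideal_matrix k d : (k <= m)%N ->
  exists2 A : 'M[K]_(N d),
    forall p : V d, (v2r p <= A)%MS <-> J k (val p) & \rank A = ideal_dim k d.
Proof.
elim: k d => [|k ih] d km.
  exists 0 => [p|]; last by rewrite mxrank0.
  rewrite submx0 prefix0; split => [/eqP h|h]; last first.
    by apply/eqP; rewrite -(linear0 v2r); congr (v2r _); apply/val_inj.
  by rewrite -[p]v2rK h linear0.
pose kk := Ordinal km.
have [A hA rA] := ih d (ltnW km).
have [d2|d2] := ltnP d 2.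
  exists A; last by rewrite rA /=; case: (d) d2 => [|[|]] //=; rewrite addn0.
  move=> p; rewrite hA; split; first exact: (@prefix_leS _ _ _ g kk).
  move=> /(@prefixS _ _ _ g kk) [r /(prefix_graded g2 d)].
  by rewrite raddfB /= (pihomogM0 _ (g2 kk)) // subr0 pihomog_dE //; exact: valP.
case: d A hA rA d2 => [|[|e]] A hA rA // _.
have [A' hA' rA'] := ih e (ltnW km).
pose mu (r : 'rV[K]_(N e)) : 'rV[K]_(N e.+2) := v2r (part e.+2 (g kk * val (r2v r))).
have mu_lin : linear mu.
  move=> c r s; rewrite /mu -[RHS]linearP; congr (v2r _); rewrite -[RHS]linearP; congr (part _ _).
  by rewrite linearP /= mulrDr -scalerAr.
pose muL := GRing.isLinear.Build K _ _ _ mu mu_lin.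
pose mu' : {linear 'rV[K]_(N e) -> 'rV[K]_(N e.+2)} := HB.pack mu muL.
pose B := lin1_mx mu'.
have valmu (p : V e) : pih e.+2 (g kk * p) = g kk * p.
  by rewrite -[e.+2]addn2 (pihomogM _ _ (g2 kk)) pihomog_dE //; apply: valP.
have muB (p : V e) : v2r p *m B = v2r (part e.+2 (g kk * val p)).
  by rewrite mul_rV_lin1 /= /mu v2rK.
have kerB : (kermx (B *m cokermx A) :=: A')%MS.
  apply/eqmxP/rV_eqP => r; rewrite sub_kermx mulmxA -submxE -[r]r2vK muB.
  apply/idP/idP; [move/hA => h; apply/hA' | move/hA' => h; apply/hA]; move: h; rewrite /= valmu.
    by case: gR => _ /(_ kk (val (r2v r))) + ?; apply; rewrite mulrC.
  by move=> h; apply: idlMl => //; apply: prefix_is_ideal.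
exists (A + B)%MS; last first.
  rewrite mxrank_adds_coker rA /= -rA' -kerB mxrank_ker subKn //.
  exact: rank_leq_row.
move=> p; split.
  case/sub_addsmxP => -[u1 u2] /= h; apply/(@prefixS _ _ _ g kk).
  exists (val (r2v u2)).
  have := hA (p - part e.+2 (g kk * val (r2v u2))).
  rewrite linearB /= -muB r2vK h addrK submxMl => -[/(_ isT)] /=.
  by rewrite valmu => h' _.
move=> /(@prefixS _ _ _ g kk) [r /(prefix_graded g2 e.+2)].
have hpi : pih e.+2 (g kk * r) = g kk * pih e r.
  by rewrite -[e.+2]addn2 (pihomogM _ _ (g2 kk)).
rewrite raddfB /= hpi pihomog_dE; last exact: valP.
move=> h; have /hA h' : J k (val (p - part e.+2 (g kk * val (part e r)))).
  by rewrite /= [pih e.+2 _](valmu (part e r)).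
set q := part e.+2 _ in h' *.
have -> : v2r p = v2r (p - q) + v2r (part e r) *m B.
  by rewrite muB -/q -[in RHS]linearD subrK.
by apply: addmx_sub_adds => //; apply: submxMl.
Qed.

(** A full-rank factorization of the cokernel of the ideal matrix gives coordinates on the degree
    [d] piece of the quotient, with target of the exact dimension. *)
Lemma quotient_coords d : exists kappa : {linear S -> 'rV[K]_('C(d + n, d) - ideal_dim m d)},
  forall p, p \is d.-homog -> kappa p = 0 <-> in_ideal g p.
Proof.
have [A hA rA] := ideal_matrix d (leqnn m).
have -> : ('C(d + n, d) - ideal_dim m d)%N = \rank (cokermx A).
  by rewrite mxrank_coker rA.
pose kap p : 'rV[K]_(\rank (cokermx A)) := v2r (part d p) *m col_base (cokermx A).
have kap_lin : linear kap by move=> c p q; rewrite /kap [part d _]linearP [v2r _]linearP mulmxDl scalemxAl.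
pose kapL := GRing.isLinear.Build K _ _ _ kap kap_lin.
pose kap' : {linear S -> 'rV[K]_(\rank (cokermx A))} := HB.pack kap kapL.
exists kap' => p hp.
have e : val (part d p) = p by rewrite /= pihomog_dE.
have hJ : in_ideal g p <-> v2r (part d p) *m cokermx A = 0.
  rewrite -[in_ideal g p]/(J m p) -{1}e -hA submxE; split=> [/eqP|->] //.
apply: iff_trans (iff_sym hJ); have := mulmx_base (cokermx A).
move: (row_base_free (cokermx A)); set R := row_base _ => Rfree cokE.
have -> : v2r (part d p) *m cokermx A = kap p *m R by rewrite -mulmxA cokE.
rewrite -[kap' p]/(kap p); split=> [->|h]; first by rewrite mul0mx.
by apply: (row_free_inj Rfree); rewrite h mul0mx.
Qed.

End QuotientDimension.

(** The dimension of [R^5]: the coefficient of [t^5] in the Hilbert series [(1 + t)^6]. *)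
Lemma ideal_dim_6_5 : ('C(5 + 5, 5) - ideal_dim 5 6 5 = 6)%N.
Proof. by vm_compute. Qed.

(** * Differentiating polynomial identities modulo an ideal *)

Section Derivatives.
Variables (K : fieldType) (n : nat).
Local Notation S := {mpoly K[n]}.
Hypothesis char0 : forall k : nat, (k%:R == 0 :> K) = (k == 0%N).

Lemma natr_inj0 j k : (j%:R == k%:R :> K) = (j == k).
Proof.
wlog jk : j k / (j <= k)%N => [h|].
  by case/orP: (leq_total j k) => /h // e; rewrite eq_sym e eq_sym.
rewrite eq_sym -subr_eq0 -natrB // char0 subn_eq0.
by rewrite eqn_leq jk.
Qed.

Section IdealCoefficients.
Variable J : S -> Prop.
Hypothesis idJ : is_ideal J.

(* Replacing [F(c)] by [F(2c) - 2^N F(c)] kills the top coefficient. *)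
Lemma ideal_interpolation N (F : nat -> S) :
  (forall c : K, J (\sum_(k < N) c ^+ k *: F k)) -> forall k, (k < N)%N -> J (F k).
Proof.
elim: N F => [//|N ih] F h.
pose r (k : nat) : K := 2 ^+ k - 2 ^+ N.
have low k : (k < N)%N -> J (F k).
  move=> kN; apply: (@idlZI _ _ _ idJ (r k)).
    by rewrite /r subr_eq0 -!natrX natr_inj0 eqn_exp2l // ltn_eqF.
  apply: (ih (fun k => r k *: F k)) kN => c.
  have -> : \sum_(k < N) c ^+ k *: (r k *: F k) =
      \sum_(k < N.+1) (2 * c) ^+ k *: F k - 2 ^+ N *: \sum_(k < N.+1) c ^+ k *: F k.
    rewrite scaler_sumr -sumrB big_ord_recr /= scalerA exprMn subrr addr0.
    by apply: eq_bigr => i _; rewrite !scalerA -scalerBl exprMn -mulrBl mulrC.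
  by apply: idlB => //; apply: idlZ.
move=> k; rewrite ltnS leq_eqVlt => /orP[/eqP->|]; last exact: low.
have := h 1; rewrite big_ord_recr /= expr1n scale1r.
set T := \sum_(i < N) _ => hT; rewrite -[F N](addKr T) addrC.
apply: idlB => //; apply: idl_sum => // i _; apply: idlZ => //; exact: low.
Qed.

(** Interpolation puts every coefficient of [P] in [J], in particular the linear one. *)
Lemma ideal_deriv (P : {poly S}) :
  (forall c : K, J P.[c%:MP]) -> J P^`().[0].
Proof.
move=> h; rewrite horner_coef0 coef_deriv mulr1n.
have [s1|s1] := ltnP 1 (size P); last by rewrite nth_default //; apply: idl0.
apply: (ideal_interpolation (N := size P) (F := fun k => P`_k)) s1 => c.
have := h c; rewrite horner_coef; congr (J _); apply: eq_bigr => k _.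
by rewrite -rmorphXn mulrC mul_mpolyC.
Qed.

End IdealCoefficients.

Definition line (a v : 'rV[K]_n) (p : S) : {poly K} :=
  mmap (@polyC K) (fun i => (a 0 i)%:P + v 0 i *: 'X) p.

Lemma horner_line a v p c : (line a v p).[c] = p.@[(a + c *: v) 0].
Proof.
elim/mpoly_ring_ind: p => [d|i|p q hp hq|p q hp hq]; rewrite /line.
- by rewrite mmapC hornerC mevalC.
- by rewrite mmapX mmap1U mevalXU hornerD hornerC hornerZ hornerX !mxE mulrC.
- by rewrite !rmorphD /= hornerD -!/(line _ _ _) hp hq.
- by rewrite !rmorphM /= hornerM -!/(line _ _ _) hp hq.
Qed.

Lemma deriv_line a v p :
  (line a v p)^`().[0] = \sum_i v 0 i * p^`M(i).@[a 0].
Proof.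
have h0 q : (line a v q).[0] = q.@[a 0] by rewrite horner_line scale0r addr0.
elim/mpoly_ring_ind: p => [d|i|p q hp hq|p q hp hq].
- rewrite /line mmapC derivC horner0 big1 // => i _.
  by rewrite mderivC meval0 mulr0.
- rewrite /line mmapX mmap1U derivD derivC add0r derivZ derivX hornerZ hornerC mulr1.
  rewrite (bigD1 i) //= big1 ?addr0 => [|j ne]; rewrite mderivX mevalZ.
    rewrite mnm1E eqxx mul1r; have -> : (U_(i) - U_(i) = 0 :> 'X_{1..n})%MM.
      by apply/mnmP => j; rewrite mnmBE subnn mnm0E.
    by rewrite mpolyX0 meval1 mulr1.
  by rewrite mnm1E eq_sym (negPf ne) mul0r mulr0.
- rewrite {1}/line rmorphD /= -!/(line _ _ _) derivD hornerD hp hq -big_split.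
  by apply: eq_bigr => i _; rewrite /= mderivD mevalD mulrDr.
- rewrite {1}/line rmorphM /= -!/(line _ _ _) derivM hornerD !hornerM hp hq !h0.
  rewrite mulr_suml mulr_sumr -big_split; apply: eq_bigr => i _ /=.
  by rewrite mderivM mevalD !mevalM mulrDr !mulrA; congr (_ + _); congr (_ * _); rewrite mulrC.
Qed.

(** On a coordinate line [p] has more roots than its degree allows, so its partial derivatives
    vanish everywhere too. By induction on the degree of [m], the coefficient at [m] times the
    nonzero [m i] is zero. *)
Lemma meval_all0 (p : S) : (forall a : 'rV_n, p.@[a 0] = 0) -> p = 0.
Proof.
move=> h; apply/mpolyP => m; rewrite mcoeff0.
elim: {m}(mdeg m) {-2}m (erefl (mdeg m)) p h => [|d ih] m hm p h.
  move/eqP: hm; rewrite mdeg_eq0 => /eqP ->.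
  rewrite -(h 0); elim/mpoly_ring_ind: p {h} => [c|i|p q hp hq|p q hp hq].
  - by rewrite mevalC mcoeffC eqxx mulr1.
  - by rewrite mevalXU mxE mcoeffX mnm1_eq0.
  - by rewrite mcoeffD mevalD hp hq.
  - by rewrite rmorphM mevalM /= hp hq.
have [i mi] : exists i, m i != 0%N.
  apply/existsP; apply/contraPT: hm => /existsPn h0.
  have -> : m = 0%MM by apply/mnmP => i; rewrite mnm0E; apply/eqP; have := h0 i; rewrite negbK.
  by rewrite mdeg0.
pose m' := (m - U_(i))%MM.
have em : m = (m' + U_(i))%MM.
  apply/mnmP => j; rewrite mnmDE mnmBE mnm1E; case: eqP => [<-|_]; last by rewrite subn0 addn0.
  by rewrite subnK // lt0n.
have hm' : mdeg m' = d by apply/eqP; move: hm; rewrite em mdegD mdeg1 addn1 => -[->].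
have hd (a : 'rV_n) : p^`M(i).@[a 0] = 0.
  have line0 : line a (delta_mx 0 i) p = 0.
    apply/eqP/negP => /negP nz; pose s := [seq k%:R : K | k <- iota 0 (size (line a (delta_mx 0 i) p))].
    have := max_poly_roots nz (rs := s); rewrite size_map size_iota ltnn => H.
    suff: false by []. apply: H.
      by apply/allP => c _; rewrite rootE horner_line h.
    rewrite map_inj_uniq ?iota_uniq // => j k /eqP; rewrite natr_inj0 => /eqP //.
  have := deriv_line a (delta_mx 0 i) p; rewrite line0 deriv0 horner0 (bigD1 i) //=.
  rewrite big1 => [|j ne]; last by rewrite mxE eqxx (negPf ne) mul0r.
  by rewrite mxE !eqxx mul1r addr0.
have := ih _ hm' _ hd; rewrite mcoeff_deriv -em -mulr_natr => /eqP.
by rewrite mulf_eq0 char0 orbF => /eqP.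
Qed.

Section VectorField.
Variable Y : 'I_n -> S.

Definition field_at (a : 'rV[K]_n) : 'rV[K]_n := \row_i (Y i).@[a 0].
(** Rows are indexed by the differentiation variable, so that [v *m jacobian a] is the derivative of
    the field at [a] in direction [v]. *)
Definition jacobian (a : 'rV[K]_n) : 'M[K]_n := \matrix_(j, i) ((Y i)^`M(j)).@[a 0].

Variable J : S -> Prop.
Hypothesis idJ : is_ideal J.

(** The monomial restricted to the line [a + c v] is a polynomial in [c] with all values in [J], so
    its derivative at 0 is in [J]. A truncated exponent [0.-1] is harmless, since its term is
    multiplied by 0. *)
Lemma ideal_monomial_deriv i j :
  (forall a, J (rowform a ^+ i * rowform (field_at a) ^+ j)) ->
  forall a v : 'rV_n,
    J (rowform v * rowform a ^+ i.-1 * rowform (field_at a) ^+ j *+ i +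
       rowform a ^+ i * rowform (v *m jacobian a) * rowform (field_at a) ^+ j.-1 *+ j).
Proof.
move=> h a v.
pose xt : {poly S} := (rowform a)%:P + rowform v *: 'X.
pose yt : {poly S} := \sum_i 'X_i *: map_poly (@mpolyC n K) (line a v (Y i)).
have xc (c : K) : xt.[c%:MP] = rowform (a + c *: v).
  by rewrite hornerD hornerC hornerZ hornerX linearD linearZ /= mulrC mul_mpolyC.
have yc (c : K) : yt.[c%:MP] = rowform (field_at (a + c *: v)).
  rewrite horner_sum; apply: eq_bigr => k _.
  by rewrite hornerZ horner_map horner_line mxE mulrC mul_mpolyC.
have x'0 : xt^`().[0] = rowform v.
  by rewrite derivD derivC add0r derivZ derivX hornerZ hornerC mulr1.
have y'0 : yt^`().[0] = rowform (v *m jacobian a).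
  rewrite raddf_sum horner_sum; apply: eq_bigr => k _ /=.
  rewrite derivZ hornerZ deriv_map -[0]/((0 : K)%:MP) horner_map deriv_line.
  rewrite mulrC mul_mpolyC mxE; congr (_ *: _); apply: eq_bigr => l _.
  by rewrite mxE.
have x0 : xt.[0] = rowform a by have := xc 0; rewrite scale0r addr0 mpolyC0.
have y0 : yt.[0] = rowform (field_at a) by have := yc 0; rewrite scale0r addr0 mpolyC0.
have hJ (c : K) : J (xt ^+ i * yt ^+ j).[c%:MP].
  by rewrite hornerM !horner_exp xc yc.
clearbody xt yt; have := ideal_deriv idJ hJ; congr J.
rewrite derivM !deriv_exp !(hornerD, hornerM, hornerMn, horner_exp) x'0 y'0 x0 y0.
by rewrite mulrnAl mulrnAr mulrA.
Qed.

End VectorField.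

(** Here [S] has two roles: the entries of [P] are polynomial functions of the coefficients [a],
    while [s] and [linform a] are elements of the graded ring. *)
Lemma power_coords r (kappa : {linear S -> 'rV[K]_r}) k s :
  exists P : 'rV[S]_r, forall a : 'I_n -> K,
    map_mx (meval a) P = kappa (linform a ^+ k * s).
Proof.
elim: k s => [|k ih] s.
  exists (map_mx (@mpolyC n K) (kappa s)) => a; rewrite expr0 mul1r.
  by apply/rowP => i; rewrite !mxE mevalC.
have [P hP] := fin_all_exists (fun i => ih ('X_i * s)).
exists (\sum_i 'X_i *: P i) => a.
have -> : linform a ^+ k.+1 * s = \sum_i a i *: (linform a ^+ k * ('X_i * s)).
  rewrite exprSr -mulrA mulr_suml mulr_sumr; apply: eq_bigr => i _.
  by rewrite -!scalerAl -scalerAr.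
rewrite !raddf_sum /=; apply: eq_bigr => i _.
by rewrite linearZ map_mxZ /= mevalXU hP.
Qed.

End Derivatives.

(** * Rank inequalities for flags of kernels *)

Section RankInequalities.
Variables (F : fieldType) (n : nat).

Lemma mxrank_le_ker r s (A : 'M[F]_(n, r)) (B : 'M[F]_(n, s)) :
  (forall v : 'rV_n, v *m A = 0 -> v *m B = 0) -> (\rank B <= \rank A)%N.
Proof.
move=> h; have : (kermx A <= kermx B)%MS.
  by apply/rV_subP => v; rewrite !sub_kermx => /eqP /h ->.
move/mxrankS; rewrite !mxrank_ker leq_sub2lE //; exact: rank_leq_row.
Qed.

(** The rank of [A] is at most that of [D *m G], hence of [E *m G]; rank-nullity for [G] on [E]
    concludes. *)
Lemma mxrank_cap_ker r s (E D : 'M[F]_n) (G : 'M[F]_(n, r)) (A : 'M[F]_(n, s)) :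
    (D <= E)%MS -> (forall v : 'rV_n, v *m D *m G = 0 -> v *m A = 0) ->
  (\rank (E :&: kermx G)%MS + \rank A <= \rank E)%N.
Proof.
move=> DE h; rewrite -(mxrank_mul_ker E G) addnC leq_add2r.
apply: leq_trans (mxrankS (submxMr G DE)).
by apply: mxrank_le_ker => v; rewrite mulmxA; apply: h.
Qed.

Lemma mxrank_gt0 m (E : 'M[F]_(m, n)) (u : 'rV[F]_n) :
  u != 0 -> (u <= E)%MS -> (0 < \rank E)%N.
Proof.
move=> u0; rewrite lt0n mxrank_eq0; apply: contraL => /eqP ->.
by apply: contraNN u0 => /submx0null ->.
Qed.

(* [u] is a nonzero vector common to all kernels and [D] maps the kernel flag
   one step down, so each step of the flag is as large as the rank of [A]. *)
Lemma mxrank_flag2 r0 r1 (D : 'M[F]_n) (A : 'M[F]_(n, r0)) (G : 'M[F]_(n, r1)) (u : 'rV_n) :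
    u != 0 -> u *m A = 0 -> u *m G = 0 -> D *m A = 0 ->
    (forall v : 'rV_n, v *m D *m G = 0 -> v *m A = 0) ->
  (2 * \rank A < n)%N.
Proof.
move=> u0 uA uG DA h.
have DE : (D <= kermx A)%MS by rewrite sub_kermx DA.
have := mxrank_cap_ker DE h; rewrite mxrank_ker => h1.
have : (0 < \rank (kermx A :&: kermx G)%MS)%N.
  by apply: (mxrank_gt0 u0); rewrite sub_capmx !sub_kermx uA uG !eqxx.
have := rank_leq_row A; lia.
Qed.

(** The flag is now the whole space, [ker A], [ker A] with [ker G], and all three kernels together;
    the last drop comes from [D *m D]. *)
Lemma mxrank_flag3 r0 r1 r2 (D : 'M[F]_n) (A : 'M[F]_(n, r0)) (G : 'M[F]_(n, r1))
    (H : 'M[F]_(n, r2)) (u : 'rV_n) :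
    u != 0 -> u *m A = 0 -> u *m G = 0 -> u *m H = 0 ->
    D *m A = 0 -> D *m D *m G = 0 ->
    (forall v : 'rV_n, v *m D *m G = 0 -> v *m A = 0) ->
    (forall v : 'rV_n, v *m (D *m D) *m H = 0 -> v *m A = 0) ->
  (3 * \rank A < n)%N.
Proof.
move=> u0 uA uG uH DA DDG hG hH.
have DE : (D <= kermx A)%MS by rewrite sub_kermx DA.
have DDE : (D *m D <= kermx A :&: kermx G)%MS.
  by rewrite sub_capmx !sub_kermx DDG -mulmxA DA mulmx0 !eqxx.
have := mxrank_cap_ker DE hG; rewrite mxrank_ker => h1.
have h2 := mxrank_cap_ker DDE hH.
have : (0 < \rank (kermx A :&: kermx G :&: kermx H)%MS)%N.
  by apply: (mxrank_gt0 u0); rewrite !sub_capmx !sub_kermx uA uG uH !eqxx.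
have := rank_leq_row A; lia.
Qed.

End RankInequalities.

(** * Descent on the vanishing monomials [x^i y^j] *)

Section Stages.
Variable K : fieldType.
Hypothesis char0 : forall k : nat, (k%:R == 0 :> K) = (k == 0%N).
Local Notation S := {mpoly K[6]}.
Variable q : 'I_6 -> S.
Hypothesis q2 : forall j, q j \is 2.-homog.
Hypothesis qR : regular_sequence q.
Local Notation I := (in_ideal q).
Let idI : is_ideal I := in_ideal_is_ideal q.

Lemma ideal_linear (u : 'rV[K]_6) : I (rowform u) -> u = 0.
Proof.
move=> [c hc]; apply/eqP; rewrite -rowform_eq0.
have := pihomog_dE (rowform_homog u); rewrite hc raddf_sum big1 /= => [<- //|j _].
by rewrite mulrC (pihomogM0 _ (q2 j)).
Qed.

Lemma idlMnI k (s : S) : I (s *+ k.+1) -> I s.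
Proof.
move=> h; apply: (idlZI idI (c := k.+1%:R)); first by rewrite char0.
by rewrite scaler_nat.
Qed.

Lemma idlMn k (s : S) : I s -> I (s *+ k).
Proof. by move=> h; rewrite -mulr_natr; apply: idlMr. Qed.

Lemma idl_addl (s t : S) : I (s + t) -> I t -> I s.
Proof. by move=> h1 h2; rewrite -(addrK t s); apply: idlB. Qed.

Lemma idl_addr (s t : S) : I (s + t) -> I s -> I t.
Proof. by rewrite addrC; apply: idl_addl. Qed.

Lemma mul_matrix d (f : S) : f \is d.-homog ->
  exists r, exists A : 'M[K]_(6, r), forall v, v *m A = 0 <-> I (f * rowform v).
Proof.
move=> hf; have [kappa hk] := quotient_coords (n := 5) q2 qR d.+1.
pose mu v := kappa (f * rowform v).
have mu_lin : linear mu.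
  by move=> c u v; rewrite /mu linearP mulrDr -scalerAr linearP.
pose muL := GRing.isLinear.Build K _ _ _ mu mu_lin.
pose mu' : {linear 'rV[K]_6 -> 'rV[K]_('C(d.+1 + 5, d.+1) - ideal_dim 5 6 d.+1)} := HB.pack mu muL.
exists _, (lin1_mx mu') => v; rewrite mul_rV_lin1 -hk //.
by rewrite -[d.+1]addn1; apply: dhomogM => //; apply: rowform_homog.
Qed.

(** The kernel of [A] then contains more than [d] independent linear forms annihilating [f]. *)
Lemma mul_rank d (f : S) r (A : 'M[K]_(6, r)) : f \is d.-homog ->
  (forall v, v *m A = 0 <-> I (f * rowform v)) -> (\rank A + d < 6)%N -> I f.
Proof.
move=> hf hA rd; apply: (ann_submx q2 qR hf (A := kermx A)).
  by rewrite mxrank_ker; lia.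
by move=> v; rewrite sub_kermx => /eqP /hA.
Qed.

Lemma ideal_flag2 d (f g : S) (u : 'rV[K]_6) (D : 'M[K]_6) :
    f \is d.-homog -> g \is d.-homog -> (d <= 3)%N -> u != 0 ->
    I (f * rowform u) -> I (g * rowform u) ->
    (forall v, I (f * rowform (v *m D))) ->
    (forall v, I (g * rowform (v *m D)) -> I (f * rowform v)) ->
  I f.
Proof.
move=> hf hg d3 u0 fu gu fD fg.
have [r0 [A hA]] := mul_matrix hf; have [r1 [G hG]] := mul_matrix hg.
apply: (mul_rank hf hA).
(* The rank is at most 2, which together with [d <= 3] stays below 6. *)
suff : (2 * \rank A < 6)%N by lia.
apply: (@mxrank_flag2 _ _ _ _ D A G u) => //; first exact/hA.
- exact/hG.
- by apply/row_matrixP => i; rewrite row0 row_mul rowE; apply/hA.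
- by move=> v /hG /fg /hA.
Qed.

Lemma ideal_flag3 d (f g h : S) (u : 'rV[K]_6) (D : 'M[K]_6) :
    f \is d.-homog -> g \is d.-homog -> h \is d.-homog -> (d <= 4)%N -> u != 0 ->
    I (f * rowform u) -> I (g * rowform u) -> I (h * rowform u) ->
    (forall v, I (f * rowform (v *m D))) ->
    (forall v, I (g * rowform (v *m D *m D))) ->
    (forall v, I (g * rowform (v *m D)) -> I (f * rowform v)) ->
    (forall v, I (h * rowform (v *m D *m D)) -> I (f * rowform v)) ->
  I f.
Proof.
move=> hf hg hh d4 u0 fu gu hu fD gD fg fh.
have [r0 [A hA]] := mul_matrix hf; have [r1 [G hG]] := mul_matrix hg.
have [r2 [H hH]] := mul_matrix hh.
apply: (mul_rank hf hA).
(* The rank is at most 1, which leaves room for [d = 4]. *)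
suff : (3 * \rank A < 6)%N by lia.
apply: (@mxrank_flag3 _ _ _ _ _ D A G H u) => //; first exact/hA.
- exact/hG.
- exact/hH.
- by apply/row_matrixP => i; rewrite row0 row_mul rowE; apply/hA.
- by apply/row_matrixP => i; rewrite row0 row_mul row_mul rowE; apply/hG.
- by move=> v /hG /fg /hA.
- by move=> v; rewrite mulmxA => /hH /fh /hA.
Qed.

Variable Y : 'I_6 -> S.
Local Notation x a := (rowform a).
Local Notation y a := (rowform (field_at Y a)).
Local Notation D a := (jacobian Y a).

Definition vanishing i j := forall a : 'rV[K]_6, I (x a ^+ i * y a ^+ j).

Lemma monomial_homog i j a : x a ^+ i * y a ^+ j \is (i + j).-homog.
Proof.
by apply: dhomogM; rewrite -[X in X.-homog]mul1n; apply: dhomogMn; apply: rowform_homog.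
Qed.

Lemma vanishing_deriv i j a v : vanishing i j.+1 ->
  I (x a ^+ i.-1 * y a ^+ j.+1 * rowform v *+ i +
     x a ^+ i * y a ^+ j * rowform (v *m D a) *+ j.+1).
Proof.
move=> h; have := ideal_monomial_deriv char0 idI h a v; congr (I (_ *+ _ + _ *+ _)).
  by rewrite -mulrA mulrC.
by rewrite /= -!mulrA; congr (_ * _); rewrite mulrC.
Qed.

(** Multiplying the differentiated relation by [y] kills the Jacobian term and leaves
    [x^i y^(j+2) v = 0] for all [v]; the degree is at most 5, so the socle argument applies. *)
Lemma vanishing_shift i j : (i + j <= 3)%N -> vanishing i.+1 j.+1 -> vanishing i j.+2.
Proof.
move=> ij h a; apply: (ann_all q2 qR (monomial_homog i j.+2 a)).
  by lia.
move=> v; have /(idlMr idI (y a)) := vanishing_deriv a v h.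
rewrite mulrDl !mulrnAl => /idl_addl H; apply: (@idlMnI i).
rewrite exprSr mulrA [X in I (X *+ _)]mulrAC; apply: H; apply: idlMn.
by rewrite mulrAC -[X in X * _]mulrA -exprSr; apply: idlMr.
Qed.

Lemma vanishing_mul i j a : vanishing i j.+1 -> I (x a ^+ i * y a ^+ j * y a).
Proof. by move=> h; rewrite -mulrA -exprSr; apply: h. Qed.

Lemma vanishing_jacobian i j a v : vanishing i j.+1 ->
  (i = 0%N \/ vanishing i.-1 j.+1) -> I (x a ^+ i * y a ^+ j * rowform (v *m D a)).
Proof.
move=> h h'; apply: (@idlMnI j); apply: idl_addr (vanishing_deriv a v h) _.
case: h' => [->|h']; first by rewrite mulr0n; apply: idl0.
by apply: idlMn; apply: idlMr.
Qed.

(** This lemma and [vanishing_raise] read one differentiated relation in its two directions: if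
    either of its terms vanishes, so does the other. *)
Lemma vanishing_lower i j a v : vanishing i.+1 j.+1 ->
  I (x a ^+ i.+1 * y a ^+ j * rowform (v *m D a)) ->
  I (x a ^+ i * y a ^+ j.+1 * rowform v).
Proof.
move=> h h'; apply: (@idlMnI i); apply: idl_addl (vanishing_deriv a v h) _.
exact: idlMn.
Qed.

Lemma vanishing_raise i j a v : vanishing i.+1 j.+1 ->
  I (x a ^+ i * y a ^+ j.+1 * rowform v) ->
  I (x a ^+ i.+1 * y a ^+ j * rowform (v *m D a)).
Proof.
move=> h h'; apply: (@idlMnI j); apply: idl_addr (vanishing_deriv a v h) _.
exact: idlMn.
Qed.

Lemma vanishing0 i j a : field_at Y a = 0 -> I (x a ^+ i * y a ^+ j.+1).
Proof. by move=> ->; rewrite linear0 expr0n mulr0; apply: idl0. Qed.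

(** The two-kernel flag is applied to [f = x^i y^(j+1)] and [g = x^(i+1) y^j], both annihilated by
    [y], with the Jacobian as [D]. *)
Lemma vanishing_step2 i j : (i + j <= 2)%N ->
    vanishing i j.+2 -> vanishing i.+1 j.+1 ->
    (i = 0%N \/ vanishing i.-1 j.+2) ->
  vanishing i j.+1.
Proof.
move=> ij h1 h2 h3 a; have [u0|u0] := eqVneq (field_at Y a) 0.
  exact: vanishing0.
apply: (@ideal_flag2 (i + j.+1) _ (x a ^+ i.+1 * y a ^+ j) _ (D a) _ _ _ u0).
- exact: monomial_homog.
- by rewrite -addSnnS; apply: monomial_homog.
- by lia.
- exact: vanishing_mul.
- exact: vanishing_mul.
- by move=> v; apply: vanishing_jacobian.
- by move=> v; apply: vanishing_lower.
Qed.

(** The three-kernel flag is applied to [x^i y^(j+2)], [x^(i+1) y^(j+1)] and [x^(i+2) y^j]; the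
    third form allows degree 4, beyond the reach of two kernels. *)
Lemma vanishing_step3 i j : (i + j <= 2)%N ->
    vanishing i j.+3 -> vanishing i.+1 j.+2 -> vanishing i.+2 j.+1 ->
    (i = 0%N \/ vanishing i.-1 j.+3) ->
  vanishing i j.+2.
Proof.
move=> ij h1 h2 h3 h4 a; have [u0|u0] := eqVneq (field_at Y a) 0.
  exact: vanishing0.
have fD v : I (x a ^+ i * y a ^+ j.+2 * rowform (v *m D a)).
  exact: vanishing_jacobian.
apply: (@ideal_flag3 (i + j.+2) _ (x a ^+ i.+1 * y a ^+ j.+1)
  (x a ^+ i.+2 * y a ^+ j) _ (D a) _ _ _ _ u0 _ _ _ fD).
- exact: monomial_homog.
- by rewrite -addSnnS; apply: monomial_homog.
- by rewrite -!addSnnS; apply: monomial_homog.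
- by lia.
- exact: vanishing_mul.
- exact: vanishing_mul.
- exact: vanishing_mul.
- by move=> v; apply: vanishing_raise (fD _).
- by move=> v; apply: vanishing_lower.
- by move=> v /(vanishing_lower h3) /(vanishing_lower h2).
Qed.

(** Differentiating [y^2 = 0] shows that [y] annihilates itself and the image of the Jacobian. A
    nonzero linear form has at most one independent linear annihilator, so that image lies on the
    line of [y], and the Jacobian term of the differentiated [x^(i+1) y = 0] vanishes. *)
Lemma vanishing_last i : (i <= 4)%N ->
  vanishing 0 2 -> vanishing i.+1 1 -> vanishing i 1.
Proof.
move=> i4 h02 h a; have [u0|u0] := eqVneq (field_at Y a) 0.
  exact: vanishing0.
set u := field_at Y a in u0 *.
have rk : (\rank (u + D a)%MS <= 1)%N.
  rewrite leqNgt; apply/negP => rk; move/eqP: u0; apply.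
  apply: ideal_linear; apply: (ann_submx q2 qR (rowform_homog u) rk).
  move=> v /sub_addsmxP [[c w]] /= ->; rewrite linearD mulrDr; apply: idlD => //.
    rewrite (mx11_scalar c) mul_scalar_mx linearZ /= -scalerAr; apply: idlZ => //.
    by have := h02 a; rewrite mul1r.
  have := vanishing_jacobian a w h02 (or_introl erefl).
  by rewrite mul1r.
have Du : (D a <= u)%MS.
  apply: submx_trans (addsmxSr u (D a)) _.
  have [_ <-] := mxrank_leqif_sup (addsmxSl u (D a)).
  rewrite eqn_leq mxrankS ?addsmxSl //= (leq_trans rk) // lt0n mxrank_eq0.
  exact: u0.
apply: (ann_all q2 qR (monomial_homog i 1 a)); first by lia.
move=> v; apply: (vanishing_lower h).
have /sub_rVP [c ->] : (v *m D a <= u)%MS by apply: submx_trans (submxMl _ _) Du.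
rewrite linearZ /= -scalerAr; apply: idlZ => //; rewrite expr0 mulr1.
exact: h.
Qed.

Lemma vanishing_field_at : vanishing 4 1 -> forall a, field_at Y a = 0.
Proof.
move=> h41.
have h32 : vanishing 3 2 by apply: vanishing_shift.
have h23 : vanishing 2 3 by apply: vanishing_shift.
have h14 : vanishing 1 4 by apply: vanishing_shift.
have h05 : vanishing 0 5 by apply: vanishing_shift.
(* Within each total degree the exponent of [x] increases, because each step uses the preceding
   entry as its hypothesis on [i.-1]. *)
have h04 : vanishing 0 4 by apply: vanishing_step3 => //; left.
have h13 : vanishing 1 3 by apply: vanishing_step3 => //; right.
have h22 : vanishing 2 2 by apply: vanishing_step3 => //; right.
have h03 : vanishing 0 3 by apply: vanishing_step2 => //; left.
have h12 : vanishing 1 2 by apply: vanishing_step2 => //; right.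
have h02 : vanishing 0 2 by apply: vanishing_step2 => //; left.
have h31 := vanishing_last (i := 3) isT h02 h41.
have h21 := vanishing_last (i := 2) isT h02 h31.
have h11 := vanishing_last (i := 1) isT h02 h21.
have h01 := vanishing_last (i := 0) isT h02 h11.
by move=> a; apply: ideal_linear; have := h01 a; rewrite mul1r.
Qed.

End Stages.

(** * The determinant of multiplication by [x^4] *)

Theorem mainTheorem9 (K : closedFieldType) (hK : [pchar K] =i pred0)
    (q : 'I_6 -> {mpoly K[6]}) :
  CI_quadric_presentation q ->
  exists2 P : {mpoly K[6]}, P != 0 &
    forall a : 'I_6 -> K, P.@[a] != 0 -> mul_pow4_iso_1_5 q (linform a).
Proof.
case=> q2 qR; have char0 := (pcharf0P K).1 hK.
have idI := in_ideal_is_ideal q.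
have x4 (a : 'I_6 -> K) : linform a ^+ 4 \is 4.-homog.
  by rewrite -[X in X.-homog]mul1n; apply: dhomogMn; apply: linform_homog.
(* Six coordinates on [R^5] make the matrix of [x^4] square. *)
have [kappa hk] : exists kappa : {linear {mpoly K[6]} -> 'rV[K]_6},
    forall p, p \is 5.-homog -> kappa p = 0 <-> in_ideal q p.
  by have := quotient_coords (n := 5) q2 qR 5; rewrite ideal_dim_6_5.
have [P hP] := fin_all_exists (fun i : 'I_6 => power_coords kappa 4 'X_i).
pose M : 'M[{mpoly K[6]}]_6 := \matrix_i P i.
have hM a (w : 'rV[K]_6) : w *m map_mx (meval a) M = kappa (linform a ^+ 4 * rowform w).
  rewrite mulmx_sum_row /rowform /linform mulr_sumr linear_sum.
  apply: eq_bigr => i _; rewrite -scalerAr linearZ /= -hP; congr (_ *: _).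
  by rewrite -map_row rowK.
exists (\det M).
  (* A zero determinant gives a nonzero row [v] of polynomials with [v *m M = 0]; its entries are
     the components of the vector field [y]. *)
  apply/negP => /det0P [v v0 vM].
  have h41 : vanishing q (v 0) 4 1.
    move=> a; rewrite expr1; apply/hk; first exact: dhomogM (x4 _) (rowform_homog _).
    rewrite -[rowform a]/(linform (a 0)) -hM.
    have -> : field_at (v 0) a = map_mx (meval (a 0)) v.
      by apply/rowP => i; rewrite !mxE.
    by rewrite -map_mxM vM map_mx0.
  move/negP: v0; apply; apply/eqP/rowP => i; rewrite mxE.
  apply: (meval_all0 char0) => a.
  have := vanishing_field_at char0 q2 qR h41 a.
  by move/rowP/(_ i); rewrite !mxE.
move=> a Pa.
have Mu : map_mx (meval a) M \in unitmx by rewrite unitmxE det_map_mx unitfE.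
split=> [y hy|f hf].
  rewrite (homog1_linform hy) => h.
  pose w := \row_i y@_U_(i).
  have ew : linform (fun i => y@_U_(i)) = rowform w.
    by apply: linform_eq => i; rewrite mxE.
  rewrite ew in h *; suff -> : w = 0 by rewrite linear0; apply: idl0.
  move: h => /hk; rewrite -hM => /(_ (dhomogM (x4 a) (rowform_homog w))) h.
  by rewrite -[w](mulmxK Mu) h mul0mx.
pose w := kappa f *m invmx (map_mx (meval a) M).
exists (rowform w); first exact: rowform_homog.
apply/hk; first by apply: rpredB => //; apply: (dhomogM (x4 a) (rowform_homog w)).
by rewrite linearB /= -hM mulmxKV // subrr.
Qed.
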